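(* Let $n\ge 1$ and let $S\subseteq [n]^2$ be such that $\mathcal{M}_S\not\subseteq\Sigma$ (that is, $\mathcal{M}_S$ contains at least one non-singular matrix). Then, for all $t\geq 2|S|$, $$\operatorname{Prob}\{\mathbf{c}^{\dagger}(A)\geq t\}\leq 4|S|^2 n^2\,\frac{1}{t},$$ where $\operatorname{Prob}$ denotes probability over $A\in\mathcal{R}_S$.
   Context: Notation: $[n]=\{1,\dots,n\}$; $\mathcal{M}$ is the set of $n\times n$ real matrices, $\Sigma\subset\mathcal{M}$ the subset of singular matrices. For $S\subseteq[n]^2$, $\mathcal{M}_S=\{A\in\mathcal{M}\mid a_{ij}=0 \text{ whenever } (i,j)\notin S\}$. $\mathcal{R}_S$ is the space of random $n\times n$ matrices obtained by setting $a_{ij}=0$ if $(i,j)\notin S$ and drawing all other entries independently from the standard Gaussian $N(0,1)$. For $A\in\mathcal{M}$ and $\delta>0$, $\mathcal{B}(A,\delta)=\{A'\in\mathcal{M}\mid |a'_{ij}-a_{ij}|\le\delta|a_{ij}| \text{ for all } i,j\in[n]\}$ (so zero entries are not perturbed). Componentwise condition number for matrix inversion: for non-singular $A$ and $A'$ write $\Gamma=(\gamma_{k\ell})=A^{-1}$ and $\Gamma'=(\gamma'_{k\ell})=A'^{-1}$ (for $\delta$ small all matrices in $\mathcal{B}(A,\delta)$ are non-singular). For $k,\ell\in[n]$ with $\gamma_{k\ell}\neq 0$ let $$\mathbf{c}^{\dagger}_{k\ell}(A)=\lim_{\delta\to 0}\ \sup_{A'\in\mathcal{B}(A,\delta)}\frac{|\gamma'_{k\ell}-\gamma_{k\ell}|}{\delta|\gamma_{k\ell}|};$$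 for $k,\ell$ with $\gamma_{k\ell}=0$ let $\mathbf{c}^{\dagger}_{k\ell}(A)=0$ if $\lim_{\delta\to0}\sup_{A'\in\mathcal{B}(A,\delta)}\frac{|\gamma'_{k\ell}-\gamma_{k\ell}|}{\delta}=0$, and $\mathbf{c}^{\dagger}_{k\ell}(A)=\infty$ otherwise. Then $\mathbf{c}^{\dagger}(A)=\max_{k,\ell\in[n]}\mathbf{c}^{\dagger}_{k\ell}(A)\in[0,\infty]$. The value of $\mathbf{c}^\dagger$ on singular matrices, which form a null set under the hypothesis of the claim, is immaterial. *)

(* Defs.v *)
From mathcomp Require Import all_boot all_order all_algebra.
From mathcomp Require Import all_classical all_reals all_analysis.

Set Implicit Arguments.
Unset Strict Implicit.
Unset Printing Implicit Defensive.

Import Order.TTheory GRing.Theory Num.Theory.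
Import numFieldNormedType.Exports.

Local Open Scope classical_set_scope.
Local Open Scope ring_scope.

Definition singular_mx (R : realType) (n : nat) : set 'M[R]_n :=
  [set A | A \notin unitmx].

Definition pattern_mx (R : realType) (n : nat) (S : {set 'I_n * 'I_n}) :
    set 'M[R]_n :=
  [set A | forall i j, (i, j) \notin S -> A i j = 0].

Definition cw_ball (R : realType) (n : nat) (A : 'M[R]_n) (delta : R) :
    set 'M[R]_n :=
  [set A' | forall i j, `|A' i j - A i j| <= delta * `|A i j|].

(* [invmx A'] is a junk value on a singular [A'], but for nonsingular [A] no
   matrix of [cw_ball A delta] is singular once [delta] is small enough, so
   limits as [delta --> 0^'+] do not see this convention. *)
Definition inv_err_sup (R : realType) (n : nat) (A : 'M[R]_n) (k l : 'I_n)
    (delta : R) : \bar R :=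
  ereal_sup [set (`|invmx A' k l - invmx A k l| / delta)%:E
            | A' in cw_ball A delta].

Definition inv_relerr_sup (R : realType) (n : nat) (A : 'M[R]_n) (k l : 'I_n)
    (delta : R) : \bar R :=
  ereal_sup [set (`|invmx A' k l - invmx A k l|
                    / (delta * `|invmx A k l|))%:E
            | A' in cw_ball A delta].

Definition cw_cond_inv_entry (R : realType) (n : nat) (A : 'M[R]_n)
    (k l : 'I_n) : \bar R :=
  if invmx A k l != 0 then
    lim (inv_relerr_sup A k l delta @[delta --> (0 : R)^'+])
  else if `[< inv_err_sup A k l delta @[delta --> (0 : R)^'+] --> 0%E >] then 0%E
  else +oo%E.

(* Singular matrices are assigned the value [+oo]; the maximum is taken in
   [0, +oo], whence the neutral element [0]. *)
Definition cw_cond_inv (R : realType) (n : nat) (A : 'M[R]_n) : \bar R :=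
  if A \in unitmx then
    \big[maxe/0%E]_(k < n) \big[maxe/0%E]_(l < n) cw_cond_inv_entry A k l
  else +oo%E.

Definition mutually_independent (d : measure_display) (T : measurableType d)
    (R : realType) (P : probability T R) (I : finType) (D : {set I})
    (X : I -> T -> R) : Prop :=
  forall (J : {set I}) (B : I -> set R), J \subset D ->
    (forall i, i \in J -> measurable (B i)) ->
    P (\bigcap_(i in [set` J]) (X i @^-1` B i)) =
    (\prod_(i in J) P (X i @^-1` B i))%E.

(* The Gaussian law on the matrices supported on [S], presented through an
   arbitrary random matrix [A] having that law. *)
Record gaussian_pattern_mx (d : measure_display) (T : measurableType d)
    (R : realType) (P : probability T R) (n : nat) (S : {set 'I_n * 'I_n})
    (A : T -> 'M[R]_n) : Prop := GaussianPatternMx {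
  gpm_zero : forall w, pattern_mx S (A w) ;
  gpm_measurable : forall i j, (i, j) \in S ->
    measurable_fun [set: T] (fun w => A w i j) ;
  gpm_normal : forall i j, (i, j) \in S -> forall B : set R, measurable B ->
    P ((fun w => A w i j) @^-1` B) = normal_prob 0 1 B ;
  gpm_independent : mutually_independent P S (fun ij w => A w ij.1 ij.2)
}.

(* Main.v *)
From HB Require Import structures.
Require Import Defs.
From mathcomp Require Import all_boot all_order all_algebra.
From mathcomp Require Import all_classical all_reals all_analysis.
From mathcomp Require Import measurable_realfun ring lra.

(* Write [G := A^-1].  To first order [G k l] varies by [- G k i * G j l * h]
   when [A i j] varies by [h], so the condition number of that entry is
   [\sum_(i, j) |G k i * A i j * G j l| / |G k l|].  As [G k l] is the quotient
   of [(\adj A) k l] by [\det A], each summand is at most the sum of the relative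
   sensitivities to [A i j] of these two polynomials.  Both are affine in each
   entry: as a function of [x := A i j] they have the form [x * E + F] with [E]
   and [F] independent of [x], and for a standard Gaussian [x] the event
   [tau * |x * E + F| <= |x * E|] has probability at most [1 / (tau - 1)] when
   [E != 0].  The theorem is the union bound over these events for
   [tau = t / (2 * #|S|)]; the determinant events are common to all [k, l]. *)

Set Implicit Arguments.
Unset Strict Implicit.
Unset Printing Implicit Defensive.

Import Order.TTheory GRing.Theory Num.Theory.
Import numFieldNormedType.Exports.

Local Open Scope classical_set_scope.
Local Open Scope ring_scope.

(** * Multiaffine functions of a matrix *)

Definition multiaffine (R : comNzRingType) (n : nat) (f : 'M[R]_n -> R) :=
  forall i j B x, f (B + x *: delta_mx i j) =
    f B + x * (f (B + delta_mx i j) - f B).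

(** For multiaffine [f] this unit difference is the partial derivative of [f] at [B] with respect to
    the entry [(i, j)]. *)
Definition slope (R : comNzRingType) (n : nat) (f : 'M[R]_n -> R) i j B :=
  f (B + delta_mx i j) - f B.

(** An affine function has constant slope. Hence the slope of [f] at a Gaussian matrix depends only
    on the entries other than [(i, j)], and is independent of that entry. *)
Lemma slopeD (R : comNzRingType) (n : nat) (f : 'M[R]_n -> R) i j B x :
  multiaffine f -> slope f i j (B + x *: delta_mx i j) = slope f i j B.
Proof.
move=> fA; rewrite /slope -addrA -[X in _ *: _ + X]scale1r -scalerDl !fA; ring.
Qed.

Lemma multiaffine_det (R : comNzRingType) (n : nat) :
  multiaffine (fun B : 'M[R]_n => \det B).
Proof.
move=> i j B x.
(* Row [i] of the perturbed matrix combines the rows of [B] and [B + delta_mx i j] with weights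
   [1 - x] and [x]. *)
rewrite (@determinant_multilinear _ _ (B + x *: delta_mx i j) B
  (B + delta_mx i j) i (1 - x) x); first by ring.
- by apply/rowP => k; rewrite !mxE eqxx /=; ring.
- by apply/matrixP => a b; rewrite !mxE eq_sym (negbTE (neq_lift _ _)) /=; ring.
- by apply/matrixP => a b; rewrite !mxE eq_sym (negbTE (neq_lift _ _)) /=; ring.
Qed.

(** The minor ignores an entry of the deleted row or column; any other entry of [B] is an entry of
    the minor, whose determinant is multiaffine. *)
Lemma multiaffine_cofactor (R : comNzRingType) (n : nat) (l k : 'I_n) :
  multiaffine (fun B : 'M[R]_n => cofactor B l k).
Proof.
move=> i j B x; rewrite /cofactor.
pose M (C : 'M[R]_n) := row' l (col' k C).
rewrite -/(M (B + _)) -/(M B) -/(M (B + delta_mx i j)).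
have ME y : M (B + y *: delta_mx i j) = M B + y *: M (delta_mx i j).
  by apply/matrixP => a b; rewrite !mxE.
have ME1 := ME 1; rewrite !scale1r in ME1; rewrite ME ME1.
have [<-|/unlift_some[i' -> _]] := eqVneq l i.
  have -> : M (delta_mx l j) = 0.
    by apply/matrixP => a b; rewrite !mxE eq_sym (negbTE (neq_lift _ _)).
  by rewrite scaler0 addr0; ring.
have [<-|/unlift_some[j' -> _]] := eqVneq k j.
  have -> : M (delta_mx (lift l i') k) = 0.
    apply/matrixP => a b.
    by rewrite !mxE [lift k b == k]eq_sym (negbTE (neq_lift _ _)) andbF.
  by rewrite scaler0 addr0; ring.
have -> : M (delta_mx (lift l i') (lift k j')) = delta_mx i' j'.
  by apply/matrixP => a b; rewrite !mxE !(inj_eq lift_inj).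
by rewrite multiaffine_det; ring.
Qed.

Lemma multiaffine_adj (R : comNzRingType) (n : nat) (k l : 'I_n) :
  multiaffine (fun B : 'M[R]_n => (\adj B) k l).
Proof. by move=> i j B x; rewrite !mxE multiaffine_cofactor. Qed.

(** Laplace expansion along row [i]: its cofactors do not involve row [i]. *)
Lemma slope_det (R : comNzRingType) (n : nat) (B : 'M[R]_n) i j :
  slope (fun B : 'M[R]_n => \det B) i j B = (\adj B) j i.
Proof.
rewrite /slope (expand_det_row (B + _) i) (expand_det_row B i) -sumrB.
have cE k : cofactor (B + delta_mx i j) i k = cofactor B i k.
  rewrite /cofactor; congr (_ * \det _); apply/matrixP => a b.
  by rewrite !mxE eq_sym (negbTE (neq_lift _ _)) addr0.
rewrite (bigD1 j)//= big1 => [|k /negbTE kj]; rewrite cE !mxE eqxx.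
  by rewrite eqxx addr0 /= mulrDl mul1r addrC addKr.
by rewrite kj addr0 subrr.
Qed.

(* Compare the terms linear in [x] in
   [(B + x *: D) *m \adj (B + x *: D) = (\det (B + x *: D))%:M], with
   [D = delta_mx i j], both sides being affine in [x] entrywise. *)
Lemma slope_adj (R : numDomainType) (n : nat) (B : 'M[R]_n) i j k l :
  \det B * slope (fun B => (\adj B) k l) i j B =
  (\adj B) j i * (\adj B) k l - (\adj B) k i * (\adj B) j l.
Proof.
pose D : 'M[R]_n := delta_mx i j.
have [E EE adjE] : exists2 E : 'M[R]_n,
    E k l = slope (fun B => (\adj B) k l) i j B &
    forall x, \adj (B + x *: D) = \adj B + x *: E.
  exists (\adj (B + D) - \adj B) => [|x]; first by rewrite /slope !mxE.
  by apply/matrixP => a b; rewrite multiaffine_adj !mxE.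
have detE x : \det (B + x *: D) = \det B + x * (\adj B) j i.
  by rewrite multiaffine_det -slope_det.
have Hx x : x *: (B *m E + D *m \adj B) + x ^+ 2 *: (D *m E) =
    (x * (\adj B) j i)%:M.
  have := mul_mx_adj (B + x *: D).
  rewrite adjE detE mulmxDl !mulmxDr mul_mx_adj -!scalemxAl -!scalemxAr.
  rewrite [RHS]raddfD/= -!addrA => /addrI <-.
  by rewrite scalerDr scalerA expr2 !addrA.
have H : B *m E + D *m \adj B = ((\adj B) j i)%:M.
  (* Subtracting the identities at [1] and [-1] cancels the quadratic term and leaves twice the
     linear one. *)
  move: (Hx 1) (Hx (-1)); rewrite sqrrN !expr1n !scale1r mul1r mulN1r scaleN1r.
  set X := B *m E + _; set Y := D *m E => H1 H2.
  apply/matrixP => a b.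
  have := congr1 (fun M : 'M[R]_n => M a b) H1; rewrite mxE.
  have := congr1 (fun M : 'M[R]_n => M a b) H2; rewrite mxE [(- X) _ _]mxE.
  rewrite [_%:M in X in X -> _]raddfN/= [(- _%:M) _ _]mxE.
  set p := _%:M a b; move: (X a b) (Y a b) p => x y p h1 h2.
  have : (x - p) *+ 2 = 0.
    rewrite mulr2n; transitivity ((x + y - p) - (- x + y + p)); first by ring.
    by rewrite h1 h2; ring.
  by move/eqP; rewrite mulrn_eq0 /= subr_eq0 => /eqP.
(* Left multiplication by [\adj B] turns [B *m E] into [\det B *: E], whose [(k, l)] entry is the
   left side sought. *)
have := congr1 (fun M => \adj B *m M) H.
rewrite mulmxDr !mulmxA mul_adj_mx mul_scalar_mx mul_mx_scalar.
move=> /(congr1 (fun M : 'M[R]_n => M k l)).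
rewrite -EE [in X in X -> _]mxE [(_ *: E) k l]mxE [(_ *: \adj B) k l]mxE.
rewrite [X in _ + X = _ -> _]mxE.
set s := \sum_(_ < _) _.
have -> : s = (\adj B) k i * (\adj B) j l.
  rewrite /s (bigD1 j)//= big1 ?addr0 => [|c cj]; last first.
    rewrite mxE big1 ?mul0r// => b _; rewrite [delta_mx _ _ _ _]mxE.
    by rewrite (negbTE cj) andbF mulr0.
  rewrite mxE (bigD1 i)//= big1 ?addr0 => [|b bi]; last first.
    by rewrite [delta_mx _ _ _ _]mxE (negbTE bi) mulr0.
  by rewrite [delta_mx _ _ _ _]mxE !eqxx mulr1.
by move=> <-; ring.
Qed.

(** * First-order perturbation of the inverse *)

Section mx_norm_bounds.
Variable R : realFieldType.

Lemma le_mx_entry (m n : nat) (X : 'M[R]_(m, n)) i j : `|X i j| <= `|X|.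
Proof.
rewrite /Num.norm/= mx_normrE.
exact: (le_bigmax _ (fun ij : 'I_m * 'I_n => `|X ij.1 ij.2|) (i, j)).
Qed.

Lemma mx_norm_le (m n : nat) (X : 'M[R]_(m, n)) c : 0 <= c ->
  (forall i j, `|X i j| <= c) -> `|X| <= c.
Proof.
by move=> c0 Xc; rewrite [leLHS]/Num.norm/= mx_normrE; apply: bigmax_le.
Qed.

(** The norm is the largest modulus of an entry, so submultiplicativity costs the inner dimension as
    a factor. *)
Lemma mx_norm_mul (m n p : nat) (X : 'M[R]_(m, n)) (Y : 'M[R]_(n, p)) :
  `|X *m Y| <= n%:R * `|X| * `|Y|.
Proof.
apply: mx_norm_le => [|i j]; first by rewrite !mulr_ge0.
rewrite mxE (le_trans (ler_norm_sum _ _ _))//.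
rewrite -mulrA mulr_natl -[X in _ *+ X]card_ord -sumr_const.
by apply: ler_sum => k _; rewrite normrM ler_pM// le_mx_entry.
Qed.

(** A vector [v] killed by [1%:M + K] satisfies [v = - v *m K], which contracts its norm unless
    [v = 0]. *)
Lemma unitmx_1D (n : nat) (K : 'M[R]_n) :
  n%:R * `|K| < 1 -> 1%:M + K \in unitmx.
Proof.
move=> K1; rewrite -row_free_unit; apply: inj_row_free => v.
rewrite mulmxDr mulmx1 => /eqP; rewrite addr_eq0 => /eqP vE.
have := mx_norm_mul v K; rewrite -normrN -vE mulrAC -[leLHS]mul1r.
have [->//|v0] := eqVneq v 0.
by rewrite ler_pM2r ?normr_gt0// leNgt K1.
Qed.

(** Using the resolvent identity [G' - G = - (G *m D *m G')] twice leaves the remainder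
    [G *m D *m (G *m D *m G')]. Used once, with [q <= 2^-1], it bounds the norm of [G'] by twice
    that of [G]. *)
Lemma invmx_perturb (n : nat) (A D : 'M[R]_n) : A \in unitmx ->
  n%:R * `|invmx A *m D| <= 2^-1 ->
  `|invmx (A + D) - invmx A + invmx A *m D *m invmx A|
    <= 2 * `|invmx A| * (n%:R * `|invmx A *m D|) ^+ 2.
Proof.
move=> Au; set G := invmx A; set q := n%:R * _ => q2.
have q0 : 0 <= q by rewrite mulr_ge0.
have A'E : A + D = A *m (1%:M + G *m D).
  by rewrite mulmxDr mulmx1 mulmxA mulmxV// mul1mx.
have A'u : A + D \in unitmx.
  by rewrite A'E unitmx_mul Au unitmx_1D// (le_lt_trans q2)// invf_lt1 ?ltr1n.
set G' := invmx (A + D).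
have GE : G' - G = - (G *m D *m G').
  have -> : D = (A + D) - A by rewrite addrC addKr.
  rewrite mulmxBr mulmxBl -mulmxA mulmxV// mulmx1 mulVmx// mul1mx.
  by rewrite opprB.
have qE X : `|G *m D *m X| <= q * `|X| by exact: mx_norm_mul.
have G'2 : `|G'| <= 2 * `|G|.
  have : `|G'| <= `|G| + q * `|G'|.
    rewrite -[leLHS]/(`|G'|) -[in leLHS](subrK G G') addrC GE.
    by rewrite (le_trans (ler_normB _ _))// lerD2l qE.
  have : q * `|G'| <= 2^-1 * `|G'| by rewrite ler_wpM2r.
  lra.
have -> : G' - G + G *m D *m G = G *m D *m (G *m D *m G').
  by rewrite -[X in _ = _ *m X]opprK -GE mulmxN mulmxBr GE opprB addrC.
rewrite (_ : 2 * _ * _ = q * (q * (2 * `|G|))); last by ring.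
by rewrite (le_trans (qE _ _))// ler_wpM2l// (le_trans (qE _ _))// ler_wpM2l.
Qed.

End mx_norm_bounds.

Definition inv_sens (R : realType) (n : nat) (A : 'M[R]_n) k l :=
  \sum_i \sum_j `|invmx A k i * A i j * invmx A j l|.

Lemma mulmx3E (R : comNzRingType) (n : nat) (X Y Z : 'M[R]_n) k l :
  (X *m Y *m Z) k l = \sum_i \sum_j X k i * Y i j * Z j l.
Proof.
rewrite mxE exchange_big; apply: eq_bigr => j _.
by rewrite mxE mulr_suml.
Qed.

(* The first-order variation [- A^-1 *m D *m A^-1] of the inverse has its
   [(k, l)] entry of modulus at most [delta * inv_sens A k l] on
   [cw_ball A delta], with equality for a suitable choice of signs. *)
Lemma inv_err_sup_bounds (R : realType) (n : nat) (A : 'M[R]_n) k l c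
    (q := n%:R * (n%:R * `|invmx A| * `|A|)) (C := 2 * `|invmx A| * q ^+ 2 / c)
    (delta : R) :
  A \in unitmx -> 0 < c -> 0 < delta -> q * delta <= 2^-1 ->
  ((inv_sens A k l / c - C * delta)%:E <=
    ereal_sup [set (`|invmx A' k l - invmx A k l| / (delta * c))%:E
              | A' in cw_ball A delta] <=
    (inv_sens A k l / c + C * delta)%:E)%E.
Proof.
move=> Au c0 d0 qd; set G := invmx A; set Sg := inv_sens A k l.
have q0 : 0 <= q by rewrite !mulr_ge0.
have approx A' : cw_ball A delta A' ->
    `|invmx A' k l - G k l + (G *m (A' - A) *m G) k l|
      <= C * c * delta ^+ 2.
  move=> AA'.
  have nD : `|A' - A| <= delta * `|A|.
    apply: mx_norm_le => [|i j]; first by rewrite mulr_ge0// ltW.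
    have := AA' i j; rewrite !mxE => /le_trans; apply.
    by rewrite ler_pM2l// le_mx_entry.
  have nGD : n%:R * `|G *m (A' - A)| <= q * delta.
    rewrite (_ : q * delta = n%:R * (n%:R * `|G| * (delta * `|A|))).
      rewrite ler_wpM2l// (le_trans (mx_norm_mul _ _))//.
      by rewrite ler_wpM2l// mulr_ge0.
    by rewrite /q; ring.
  have := invmx_perturb Au (le_trans nGD qd).
  rewrite [A + _]addrC subrK => /(le_trans (le_mx_entry _ k l)).
  rewrite !mxE => /le_trans; apply.
  rewrite /C divfK ?gt_eqF// -[leRHS]mulrA -exprMn ler_wpM2l ?mulr_ge0//.
  by rewrite lerXn2r ?nnegrE ?mulr_ge0// ltW.
have dc0 : 0 < delta * c by rewrite mulr_gt0.
have dcE : (Sg / c + C * delta) * (delta * c) =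
    delta * Sg + C * c * delta ^+ 2 by field; rewrite gt_eqF.
have dcE' : (Sg / c - C * delta) * (delta * c) =
    delta * Sg - C * c * delta ^+ 2 by field; rewrite gt_eqF.
apply/andP; split; last first.
  apply: ub_ereal_sup => _ [A' AA' <-]; rewrite lee_fin ler_pdivrMr// dcE.
  have := approx _ AA'; set e := _ * _ * _ ^+ 2 => ape.
  have : `|(G *m (A' - A) *m G) k l| <= delta * Sg.
    rewrite mulmx3E (le_trans (ler_norm_sum _ _ _))// mulr_sumr.
    apply: ler_sum => i _; rewrite (le_trans (ler_norm_sum _ _ _))// mulr_sumr.
    apply: ler_sum => j _; rewrite !normrM mulrA mulrCA !mulrA.
    rewrite ler_wpM2r// -mulrA ler_wpM2l//.
    by have := AA' i j; rewrite !mxE.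
  have := ler_normB (invmx A' k l - G k l + (G *m (A' - A) *m G) k l)
    ((G *m (A' - A) *m G) k l).
  rewrite addrK; lra.
(* Each entry is moved according to the sign of its own summand, so that the summands of the
   first-order variation add up without cancellation. *)
pose A' : 'M[R]_n := \matrix_(i, j)
  (A i j + delta * (Num.sg (G k i * A i j * G j l) * A i j)).
have AA' : cw_ball A delta A'.
  move=> i j; rewrite mxE addrC addKr normrM (gtr0_norm d0) ler_pM2l//.
  by rewrite normrM ler_piMl// normr_sg; case: (_ != 0).
apply: ereal_sup_ge; exists (`|invmx A' k l - G k l| / (delta * c))%:E.
  by exists A'.
rewrite lee_fin ler_pdivlMr// dcE'.
have := approx _ AA'; set e := _ * _ * _ ^+ 2 => ape.
have GE : (G *m (A' - A) *m G) k l = delta * Sg.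
  rewrite mulmx3E mulr_sumr; apply: eq_bigr => i _; rewrite mulr_sumr.
  apply: eq_bigr => j _; rewrite !mxE [_ + _ - _]addrC addKr.
  by rewrite normrEsg; ring.
have := ler_normB (invmx A' k l - G k l + (G *m (A' - A) *m G) k l)
  (invmx A' k l - G k l).
rewrite {1}addrC addKr {1}GE.
have := ler_norm (delta * Sg).
lra.
Qed.

(** The factor [c] serves both definitions: [c = 1] gives the absolute error, and the modulus of
    [invmx A k l] gives the relative one. *)
Lemma cvg_inv_err_sup (R : realType) (n : nat) (A : 'M[R]_n) k l c :
  A \in unitmx -> 0 < c ->
  ereal_sup [set (`|invmx A' k l - invmx A k l| / (delta * c))%:E
            | A' in cw_ball A delta] @[delta --> (0 : R)^'+]
    --> (inv_sens A k l / c)%:E.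
Proof.
move=> Au c0.
set q := n%:R * (n%:R * `|invmx A| * `|A|).
set C := 2 * `|invmx A| * q ^+ 2 / c.
have q0 : 0 <= q by rewrite !mulr_ge0.
have qsmall : \forall delta \near (0 : R)^'+, q * delta <= 2^-1.
  have [->|qN] := eqVneq q 0.
    by apply: nearW => delta; rewrite mul0r invr_ge0.
  have qp : 0 < q by rewrite lt_def qN.
  near=> delta; rewrite mulrC -ler_pdivlMr//; near: delta.
  by apply: nbhs_right_le; rewrite divr_gt0 ?invr_gt0.
have cvg0 : delta @[delta --> (0 : R)^'+] --> (0 : R).
  exact: cvg_at_right_filter.
apply: (@squeeze_cvge _ _ _ _
    (fun delta => (inv_sens A k l / c - C * delta)%:E) _
    (fun delta => (inv_sens A k l / c + C * delta)%:E)).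
- near=> delta; apply: inv_err_sup_bounds => //.
  by rewrite -/q; near: delta.
- apply: cvg_EFin; first exact: nearW.
  rewrite -[X in _ --> X]subr0 -[X in _ --> _ - X](mulr0 C).
  by apply: cvgB; [exact: cvg_cst|apply: cvgM => //; exact: cvg_cst].
- apply: cvg_EFin; first exact: nearW.
  rewrite -[X in _ --> X]addr0 -[X in _ --> _ + X](mulr0 C).
  by apply: cvgD; [exact: cvg_cst|apply: cvgM => //; exact: cvg_cst].
Unshelve. all: by end_near. Qed.

(** The first conjunct settles the case [invmx A k l = 0], where the condition number is [0] or
    [+oo] according to whether the sensitivity vanishes. Otherwise it follows from the second, as
    [t > 0]. *)
Lemma le_cw_cond_inv_entry (R : realType) (n : nat) (A : 'M[R]_n) k l t :
  A \in unitmx -> 0 < t ->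
  (t%:E <= cw_cond_inv_entry A k l)%E =
  (0 < inv_sens A k l) && (t * `|invmx A k l| <= inv_sens A k l).
Proof.
move=> Au t0; rewrite /cw_cond_inv_entry.
have S0 : 0 <= inv_sens A k l by do 2 (apply: sumr_ge0 => ? _).
have [G0|G0] := eqVneq (invmx A k l) 0 => /=.
  have err : inv_err_sup A k l delta @[delta --> (0 : R)^'+]
      --> (inv_sens A k l)%:E.
    rewrite -[inv_sens A k l]divr1.
    have := @cvg_inv_err_sup R n A k l 1 Au ltr01.
    rewrite [X in X @ _ --> _](_ : _ = inv_err_sup A k l)//.
    by apply/funext => delta; rewrite mulr1.
  rewrite G0 normr0 mulr0 S0 andbT lt0r S0 andbT.
  have [Sg0|Sg0] := eqVneq (inv_sens A k l) 0.
    rewrite Sg0 in err; move/asboolP: err => ->.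
    by rewrite lee_fin leNgt t0.
  case: asboolP => [err'|_]; last by rewrite leey.
  have := cvg_unique (@ereal_hausdorff R) err err'.
  by move=> eq0; move: Sg0; rewrite -eqe eq0 eqxx.
have G1 : 0 < `|invmx A k l| by rewrite normr_gt0.
have /(cvg_lim (@ereal_hausdorff R)) := @cvg_inv_err_sup R n A k l _ Au G1.
rewrite -/(inv_relerr_sup A k l _) => ->.
rewrite lee_fin ler_pdivlMr//; case: ltP => //= Sg0; apply/negbTE.
by rewrite -ltNge (le_lt_trans Sg0)// mulr_gt0.
Qed.

Lemma le_cw_cond_inv (R : realType) (n : nat) (A : 'M[R]_n) t :
  A \in unitmx -> 0 < t ->
  (t%:E <= cw_cond_inv A)%E =
  [exists k, exists l,
    (0 < inv_sens A k l) && (t * `|invmx A k l| <= inv_sens A k l)].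
Proof.
move=> Au t0; rewrite /cw_cond_inv Au.
apply/idP/existsP => [|[k /existsP[l]]].
  move/bigmax_geP => [|[k _]]; first by rewrite lee_fin leNgt t0.
  move/bigmax_geP => [|[l _]]; first by rewrite lee_fin leNgt t0.
  by rewrite le_cw_cond_inv_entry// => kl; exists k; apply/existsP; exists l.
rewrite -le_cw_cond_inv_entry// => kl.
apply/bigmax_geP; right; exists k => //.
by apply/bigmax_geP; right; exists l.
Qed.

(** * A small-denominator estimate for the Gaussian law *)

Lemma normal_pdf_le_norm (R : realType) (x y : R) :
  `|x| <= `|y| -> normal_pdf 0 1 y <= normal_pdf 0 1 x.
Proof.
move=> xy; rewrite !normal_pdfE ?oner_neq0// /normal_fun.
rewrite ler_wpM2l ?normal_peak_ge0// ler_expR !subr0.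
rewrite !mulNr lerN2 ler_pM2r ?invr_gt0//.
by rewrite -real_normK ?num_real// -(real_normK (num_real y)) lerXn2r ?nnegrE.
Qed.

(** The left side is the area of a rectangle over [[- y, y]] lying below the density, whose total
    mass is 1. *)
Lemma normal_pdf_mul_le (R : realType) (y : R) :
  0 <= y -> normal_pdf 0 1 y * (2 * y) <= 1.
Proof.
move=> y0; rewrite -lee_fin.
rewrite [leLHS](_ : _ =
    (\int[lebesgue_measure]_(x in `[(- y)%R, y]) (normal_pdf 0 1 y)%:E)%E);
  last first.
  rewrite integral_cst//= lebesgue_measure_itv/= lte_fin.
  case: ltP => [_|yN]; first by rewrite -EFinD -EFinM opprK mulr2n mulrDl mul1r.
  by rewrite (_ : y = 0) ?mulr0 ?mule0//; lra.
apply: (@le_trans _ _ (normal_prob 0 1 `[(- y)%R, y])); last first.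
  by apply: (@probability_le1 _ _ _ (normal_prob (0 : R) 1)).
apply: ge0_le_integral => //=.
- by move=> x _; rewrite lee_fin normal_pdf_ge0.
- apply/measurable_EFinP; apply: measurable_funTS.
  exact: measurable_normal_pdf.
- move=> x; rewrite in_itv/= => xy; rewrite lee_fin normal_pdf_le_norm//.
  by rewrite (ger0_norm y0) ler_norml.
Qed.

(* The set is an interval of center [c] and radius [r = y / (tau - 1)] on which
   [y <= |x|], so its mass is at most [2 r phi(y)], where [phi] is the density,
   while [2 y phi(y)] is at most the mass of [[- y, y]]. *)
Lemma normal_prob_ratio1 (R : realType) (m tau : R) : 1 < tau ->
  (normal_prob 0 1 [set x | (tau * `|x - m| <= `|x|)%R]
     <= ((tau - 1)^-1)%:E)%E.
Proof.
(* The endpoints are [m * tau / (tau + 1)] and [m * tau / (tau - 1)]; [y] is the modulus of the one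
   nearer to 0. *)
move=> tau1; pose c := m * tau ^+ 2 / (tau ^+ 2 - 1).
pose y := `|m| * tau / (tau + 1); pose r := y / (tau - 1).
have tau0 : 0 <= tau by lra.
have t1 : tau - 1 != 0 by lra.
have t2 : tau + 1 != 0 by lra.
have t3p : 0 < tau ^+ 2 - 1 by nra.
have t3 : tau ^+ 2 - 1 != 0 by rewrite gt_eqF.
have y0 : 0 <= y by rewrite /y divr_ge0 ?mulr_ge0//; lra.
have r0 : 0 <= r by rewrite /r divr_ge0//; lra.
(* Both inequalities are squared; the resulting differences agree up to the positive factor
   [tau ^+ 2 - 1]. *)
have memE x : (tau * `|x - m| <= `|x|) = (c - r <= x <= c + r).
  rewrite -ler_distl -ler_sqr ?nnegrE ?mulr_ge0// -[RHS]ler_sqr ?nnegrE//.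
  rewrite exprMn !real_normK ?num_real// -subr_ge0 -[RHS]subr_ge0.
  rewrite -[RHS](pmulr_rge0 _ t3p); congr (0 <= _).
  rewrite -[r ^+ 2]real_normK ?num_real// /r /y /c normrM !normrM !normfV.
  rewrite normr_id exprMn !exprMn !exprVn !real_normK ?num_real//.
  by field; rewrite t1 t2 t3.
have yx x : tau * `|x - m| <= `|x| -> y <= `|x|.
  move=> xm; rewrite ler_pdivrMr; last by lra.
  have := ler_normB x (x - m); rewrite opprB addrC subrK => mx.
  have : tau * `|m| <= tau * (`|x| + `|x - m|) by rewrite ler_wpM2l.
  lra.
rewrite (_ : [set _ | _] = `[c - r, c + r]%classic); last first.
  by apply/seteqP; split => x /=; rewrite memE in_itv.
apply: (@le_trans _ _ (\int[lebesgue_measure]_(x in `[(c - r)%R, (c + r)%R])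
    (normal_pdf 0 1 y)%:E)%E).
  apply: ge0_le_integral => //=.
  - by move=> x _; rewrite lee_fin normal_pdf_ge0.
  - apply/measurable_EFinP; apply: measurable_funTS.
    exact: measurable_normal_pdf.
  - move=> x; rewrite in_itv/= => xcr; rewrite lee_fin normal_pdf_le_norm//.
    by rewrite (ger0_norm y0) yx// memE.
rewrite integral_cst//= lebesgue_measure_itv/= lte_fin.
case: ltP => [_|rN]; last by rewrite mule0 lee_fin invr_ge0; lra.
rewrite -EFinD -EFinM lee_fin.
rewrite (_ : _ * _ = normal_pdf 0 1 y * (2 * y) * (tau - 1)^-1).
  by rewrite -[leRHS]mul1r ler_wpM2r ?normal_pdf_mul_le// invr_ge0; lra.
by rewrite /r; field.
Qed.

Lemma normal_prob_ratio (R : realType) (E F tau : R) : E != 0 -> 1 < tau ->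
  (normal_prob 0 1 [set x | (tau * `|x * E + F| <= `|x * E|)%R]
     <= ((tau - 1)^-1)%:E)%E.
Proof.
move=> E0 tau1.
rewrite (_ : [set _ | _] = [set x | (tau * `|x - (- F / E)| <= `|x|)%R]).
  exact: normal_prob_ratio1.
apply/seteqP; split => x /=.
all: have -> : x * E + F = (x - (- F / E)) * E by field.
all: by rewrite !normrM mulrA ler_pM2r ?normr_gt0.
Qed.

(** * Independence *)

Section independence.
Context d (T : measurableType d) (R : realType) (P : probability T R).
Context (I : finType) (D : {set I}) (X : I -> T -> R).

(** A pi-system generating the sigma-algebra of the variables [X i] with [i] in [J]. *)
Definition cylinders (J : {set I}) : set (set T) :=
  [set B | exists2 C : I -> set R, (forall i, i \in J -> measurable (C i)) &
    B = \bigcap_(i in [set` J]) (X i @^-1` C i)].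

Lemma cylinders_preimage (J : {set I}) i (C : set R) :
  i \in J -> measurable C -> cylinders J (X i @^-1` C).
Proof.
move=> iJ mC; exists (fun j => if j == i then C else setT) => [j _|].
  by case: ifP.
apply/seteqP; split => [w Xw j _ /=|w /(_ i iJ)/=]; last by rewrite eqxx.
by case: ifP => // /eqP ->.
Qed.

Hypothesis indX : mutually_independent P D X.
Hypothesis mX : forall i, i \in D -> measurable_fun setT (X i).

Lemma measurable_cylinders (J : {set I}) : J \subset D ->
  cylinders J `<=` measurable.
Proof.
move=> /fintype.subsetP JD _ [C mC ->];
apply: fin_bigcap_measurable => // i /= iJ.
by rewrite -[X in measurable X]setTI; apply: mX => //; [exact: JD|exact: mC].
Qed.

(** For fixed [B] both sides are finite measures in [E]. They agree on cylinders by mutual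
    independence, hence on the sigma-algebra that this pi-system generates. *)
Lemma indep_cylinders e (B : set R) (E : set T) :
  e \in D -> measurable B -> <<s cylinders (D :\ e) >> E ->
  P (X e @^-1` B `&` E) = (P (X e @^-1` B) * P E)%E.
Proof.
move=> eD mB GE.
have mXB : measurable (X e @^-1` B).
  by rewrite -[X in measurable X]setTI; exact: mX.
have fXB : P (X e @^-1` B) \is a fin_num by exact: fin_num_measure.
have p0 : 0 <= fine (P (X e @^-1` B)) by rewrite fine_ge0.
have DeD : D :\ e \subset D by rewrite subsetDl.
transitivity (mscale (NngNum p0) P E); last first.
  by rewrite /mscale -[in RHS](fineK fXB).
rewrite setIC.
apply: (@g_sigma_algebra_measure_unique _ _ _ (cylinders (D :\ e)) _
  (fun=> setT) _ _ (mrestr P mXB) (mscale (NngNum p0) P)) => //.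
- exact: measurable_cylinders.
- move=> _; exists (fun=> setT) => //.
  by apply/seteqP; split.
- exact: bigcup_const.
- move=> _ _ [C mC ->] [C' mC' ->]; exists (fun i => C i `&` C' i).
    by move=> i iD; apply: measurableI; [exact: mC|exact: mC'].
  by rewrite -bigcapI.
- move=> _ [C mC ->]; rewrite /= /mscale /mrestr [_%:num%:E](fineK fXB).
  transitivity (P (X e @^-1` B) *
      \prod_(i in D :\ e) P (X i @^-1` C i))%E; last first.
    by congr (_ * _)%E; exact/esym/(indX DeD mC).
  (* Inserting [B] at the index [e] makes the intersection a cylinder over all of [D]. *)
  pose C' i := if i == e then B else C i.
  have : P (\bigcap_(i in [set` D]) (X i @^-1` C' i)) =
      (\prod_(i in D) P (X i @^-1` C' i))%E.
    apply: indX => // i iD; rewrite /C'; case: eqVneq => // ie.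
    by apply: mC; rewrite !inE ie.
  rewrite (bigD1 e)//= {2}/C' eqxx.
  rewrite (eq_bigl [in D :\ e])/=; last by move=> i; rewrite !inE andbC.
  rewrite (eq_bigr (fun i => P (X i @^-1` C i))); last first.
    by move=> i; rewrite !inE /C' => /andP[/negbTE ->].
  move=> <-; congr (P _); apply/seteqP; split => [w [Cw Bw] i /= iD|w Cw].
    by rewrite /C'; case: eqVneq => [->//|ie]; apply: Cw; rewrite /= !inE ie.
  split => [i /=|]; last by have := Cw e eD; rewrite /C'/= eqxx.
  by rewrite !inE => /andP[ie iD]; have := Cw i iD; rewrite /C'/= (negbTE ie).
- by move=> _; rewrite /= /mrestr setTI -ge0_fin_numE.
Qed.

(** The joint law of [Y] and [X e] is the product of their laws, so the probability is the integral
    over [y] of quantities bounded by [c]. *)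
Lemma le_prob_indep d' (T' : measurableType d') (Y : T -> T') e
    (V : set (T' * R)) (c : R) :
  e \in D ->
  (forall C, measurable C -> <<s cylinders (D :\ e) >> (Y @^-1` C)) ->
  measurable V -> (forall y, (P [set w | V (y, X e w)] <= c%:E)%E) ->
  (P [set w | V (Y w, X e w)] <= c%:E)%E.
Proof.
move=> eD YG mV Vc.
have DeD : D :\ e \subset D by rewrite subsetDl.
have mY : measurable_fun setT Y.
  move=> _ C mC; rewrite setTI.
  have : <<s cylinders (D :\ e) >> `<=` measurable.
    apply: smallest_sub; first exact: sigma_algebra_measurable.
    exact: measurable_cylinders.
  by apply; exact: YG.
have mYX : measurable_fun setT (fun w => (Y w, X e w)).
  by apply: measurable_fun_pair => //; exact: mX.
pose Ym : {mfun T >-> T'} := HB.pack Y (isMeasurableFun.Build _ _ _ _ Y mY).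
pose Xm : {mfun T >-> R} :=
  HB.pack (X e) (isMeasurableFun.Build _ _ _ _ (X e) (mX eD)).
pose YXm : {mfun T >-> (T' * R)%type} :=
  HB.pack (fun w => (Y w, X e w)) (isMeasurableFun.Build _ _ _ _ _ mYX).
rewrite [leLHS](_ : _ = distribution P YXm V)//.
rewrite -(@product_measure_unique _ _ _ _ _
  (distribution P Ym) (distribution P Xm))//; last first.
  move=> B C mB mC /=; rewrite /distribution /pushforward /= muleC.
  by rewrite -indep_cylinders //; [rewrite setIC|exact: YG].
rewrite /product_measure1 (@le_trans _ _ (\int[distribution P Ym]_y c%:E)%E)//.
  apply: ge0_le_integral => //=.
  - exact: measurable_fun_xsection.
  - move=> y _; rewrite (le_trans _ (Vc y))// le_eqVlt; apply/orP; left.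
    apply/eqP; congr (P _); apply/seteqP.
    by split => w; rewrite /= /preimage /= => /xsectionP.
rewrite integral_cst//.
by have := @probability_setT _ _ _ (distribution P Ym) => /= ->; rewrite mule1.
Qed.

End independence.

(** * Multiaffine functions of a Gaussian matrix *)

Definition measurable_mx d (T : measurableType d) (R : realType) (n : nat)
    (M : T -> 'M[R]_n) :=
  forall i j, measurable_fun setT (fun w => M w i j).

(** The quantification over measurable spaces allows use both with the sigma-algebra of the sample
    space and with the smaller one generated by [cylinders]. *)
Definition mx_measurable (R : realType) (n : nat) (f : 'M[R]_n -> R) :=
  forall d (T : measurableType d) (M : T -> 'M[R]_n),
    measurable_mx M -> measurable_fun setT (fun w => f (M w)).

Lemma mx_measurable_det (R : realType) (n : nat) :
  mx_measurable (fun B : 'M[R]_n => \det B).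
Proof.
move=> d T M mM; rewrite /determinant; apply: measurable_sum => s.
apply: measurable_funM; first exact: measurable_cst.
by apply: measurable_prod => i _; exact: mM.
Qed.

Lemma mx_measurable_adj (R : realType) (n : nat) k l :
  mx_measurable (fun B : 'M[R]_n => (\adj B) k l).
Proof.
move=> d T M mM.
rewrite [X in measurable_fun _ X](_ : _ = fun w => cofactor (M w) l k);
  last by apply/funext => w; rewrite mxE.
apply: measurable_funM; first exact: measurable_cst.
apply: (@mx_measurable_det _ _ _ _ (fun w => row' l (col' k (M w)))) => i j.
rewrite [X in measurable_fun _ X](_ : _ = fun w => M w (lift l i) (lift k j)).
  exact: mM.
by apply/funext => w; rewrite !mxE.
Qed.

Lemma mx_measurable_slope (R : realType) (n : nat) (f : 'M[R]_n -> R) i j :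
  mx_measurable f -> mx_measurable (slope f i j).
Proof.
move=> mf d T M mM; apply: measurable_funB; last exact: mf.
apply: mf => k l.
rewrite [X in measurable_fun _ X](_ : _ = fun w => M w k l + delta_mx i j k l).
  by apply: measurable_funD; [exact: mM|exact: measurable_cst].
by apply/funext => w; rewrite mxE.
Qed.

Lemma measurable_set_ler d (T : measurableType d) (R : realType)
    (f g : T -> R) :
  measurable_fun setT f -> measurable_fun setT g ->
  measurable [set w | f w <= g w].
Proof.
move=> mf mg; have := measurable_fun_ler mf mg.
by move=> /(_ measurableT [set true] I); rewrite setTI.
Qed.

Lemma measurable_set_ltr d (T : measurableType d) (R : realType)
    (f g : T -> R) :
  measurable_fun setT f -> measurable_fun setT g ->
  measurable [set w | f w < g w].
Proof.
move=> mf mg; have := measurable_fun_ltr mf mg.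
by move=> /(_ measurableT [set true] I); rewrite setTI.
Qed.

Lemma measurable_set_neq0 d (T : measurableType d) (R : realType) (f : T -> R) :
  measurable_fun setT f -> measurable [set w | f w != 0].
Proof.
move=> mf; rewrite (_ : [set _ | _] = [set w | 0 < `|f w|]).
  by apply: measurable_set_ltr; [exact: measurable_cst|exact: measurableT_comp].
by apply/seteqP; split => w /=; rewrite normr_gt0.
Qed.

Lemma measurable_set_eq0 d (T : measurableType d) (R : realType) (f : T -> R) :
  measurable_fun setT f -> measurable [set w | f w = 0].
Proof.
move=> mf; rewrite (_ : [set _ | _] = ~` [set w | f w != 0]).
  by apply: measurableC; exact: measurable_set_neq0.
by apply/seteqP; split => w /=; [move=> ->; rewrite eqxx|move/negP/negPn/eqP].
Qed.

Section gaussian_pattern.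
Context d (T : measurableType d) (R : realType) (P : probability T R).
Context (n : nat) (S : {set 'I_n * 'I_n}) (A : T -> 'M[R]_n).
Hypothesis gA : gaussian_pattern_mx P S A.

Let X (ij : 'I_n * 'I_n) w := A w ij.1 ij.2.

Let mX ij : ij \in S -> measurable_fun setT (X ij).
Proof. by case: ij => i j; exact: gpm_measurable gA i j. Qed.

Lemma measurable_gaussian_pattern : measurable_mx A.
Proof.
move=> i j; have [ijS|ijS] := boolP ((i, j) \in S); first exact: (mX ijS).
rewrite (_ : (fun _ => _) = cst 0); first exact: measurable_cst.
by apply/funext => w; rewrite (gpm_zero gA).
Qed.

(** A hybrid that passes from the fixed matrix [B] at [J] empty to the random matrix [A] at [J = S],
    when [B] has pattern [S]. *)
Definition mix_mx (J : {set 'I_n * 'I_n}) (B : 'M[R]_n) w : 'M[R]_n :=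
  \matrix_(i, j) if (i, j) \in J then A w i j else B i j.

Lemma mix_mx_pattern B : pattern_mx S B -> mix_mx S B = A.
Proof.
move=> BS; apply/funext => w; apply/matrixP => i j; rewrite mxE.
by case: ifPn => // ijS; rewrite BS// (gpm_zero gA).
Qed.

Lemma mix_mx0 B w : mix_mx finset.set0 B w = B.
Proof. by apply/matrixP => i j; rewrite mxE inE. Qed.

Lemma mix_mxD1 (J : {set 'I_n * 'I_n}) B i j w : (i, j) \in J ->
  mix_mx J B w =
  mix_mx (J :\ (i, j)) B w + (A w i j - B i j) *: delta_mx i j.
Proof.
move=> ijJ; apply/matrixP => k l; rewrite !mxE !inE -xpair_eqE.
have [[-> ->]|kl] := eqVneq (k, l) (i, j); first by rewrite ijJ/=; ring.
by rewrite mulr0 addr0.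
Qed.

Lemma measurable_mix_mx (J K : {set 'I_n * 'I_n}) B : J \subset K ->
  measurable_mx (mix_mx J B : g_sigma_algebraType (cylinders X K) -> _).
Proof.
move=> /fintype.subsetP JK i j; have [ijJ|ijJ] := boolP ((i, j) \in J).
  rewrite [X in measurable_fun _ X](_ : _ = X (i, j)); last first.
    by apply/funext => w; rewrite mxE ijJ.
  move=> _ C mC; rewrite setTI; apply: sub_sigma_algebra.
  by apply: cylinders_preimage => //; exact: JK.
rewrite (_ : (fun _ => _) = cst (B i j)); first exact: measurable_cst.
by apply/funext => w; rewrite mxE (negbTE ijJ).
Qed.

Variable f : 'M[R]_n -> R.
Hypotheses (f_aff : multiaffine f) (mf : mx_measurable f).

Lemma measurable_mix_mx_all (J : {set 'I_n * 'I_n}) B :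
  J \subset S -> measurable_mx (mix_mx J B).
Proof.
move=> JS i j; have [ijJ|ijJ] := boolP ((i, j) \in J).
  rewrite [X in measurable_fun _ X](_ : _ = X (i, j)); last first.
    by apply/funext => w; rewrite mxE ijJ.
  by apply: mX; move/fintype.subsetP: JS; exact.
rewrite (_ : (fun _ => _) = cst (B i j)); first exact: measurable_cst.
by apply/funext => w; rewrite mxE (negbTE ijJ).
Qed.

(** Relative sensitivity of [f] to the entry [(i, j)] at least [tau], with the division cleared. The
    nonzero slope keeps out the trivial case of both sides being zero. *)
Definition ratio_event tau (M : T -> 'M[R]_n) i j : set T :=
  [set w | slope f i j (M w) != 0 /\
    tau * `|f (M w)| <= `|A w i j * slope f i j (M w)|].

Lemma measurable_ratio_event tau M i j :
  measurable_mx M -> measurable (ratio_event tau M i j).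
Proof.
move=> mM; have ms := mx_measurable_slope i j mf mM.
apply: measurableI; first exact: measurable_set_neq0.
apply: measurable_set_ler.
  apply: measurable_funM; first exact: measurable_cst.
  by apply: measurableT_comp => //; exact: mf.
apply: measurableT_comp => //; apply: measurable_funM => //.
exact: measurable_gaussian_pattern.
Qed.

(** Once the other entries are fixed, [f] is [x * E + F] in the Gaussian entry [x], and
    [normal_prob_ratio] applies; independence then averages this bound. *)
Lemma le_ratio_event tau (J : {set 'I_n * 'I_n}) B i j :
  J \subset S -> (i, j) \in J -> 1 < tau ->
  (P (ratio_event tau (mix_mx J B) i j) <= ((tau - 1)^-1)%:E)%E.
Proof.
move=> JS ijJ tau1.
have ijS : (i, j) \in S by move/fintype.subsetP : JS; exact.
pose M := mix_mx (J :\ (i, j)) B.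
(* [M] carries [B i j] at [(i, j)]; subtracting its contribution makes [F] the value of [f] when
   that entry is 0. *)
pose E w := slope f i j (M w); pose F w := f (M w) - B i j * E w.
pose V := [set z : (R * R) * R |
  z.1.1 != 0 /\ tau * `|z.2 * z.1.1 + z.1.2| <= `|z.2 * z.1.1|].
rewrite [X in P X](_ : _ = [set w | V ((E w, F w), X (i, j) w)]); last first.
  have slopeE w : slope f i j (mix_mx J B w) = E w.
    by rewrite (mix_mxD1 B w ijJ) slopeD.
  have fE w : f (mix_mx J B w) = X (i, j) w * E w + F w.
    by rewrite (mix_mxD1 B w ijJ) f_aff /F /E /slope /X/=; ring.
  by apply/seteqP; split => w; rewrite /ratio_event /V /= slopeE fE.
have JeS : J :\ (i, j) \subset S :\ (i, j) by exact: finset.setSD.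
have mM : measurable_mx
    (M : g_sigma_algebraType (cylinders X (S :\ (i, j))) -> _).
  exact: measurable_mix_mx.
have mE := mx_measurable_slope i j mf mM.
have mF : measurable_fun setT
    (F : g_sigma_algebraType (cylinders X (S :\ (i, j))) -> R).
  apply: measurable_funB; first exact: (mf mM).
  by apply: measurable_funM => //; exact: measurable_cst.
apply: (@le_prob_indep _ _ _ _ _ S X (gpm_independent gA) mX _ _
  (fun w => (E w, F w)) (i, j)) => //.
- move=> C mC.
  by have := measurable_fun_pair mE mF measurableT mC; rewrite setTI.
- apply: measurableI.
    by apply: measurable_set_neq0; exact: measurableT_comp.
  apply: measurable_set_ler.
    apply: measurable_funM; first exact: measurable_cst.
    apply: measurableT_comp => //; apply: measurable_funD.
      by apply: measurable_funM => //; exact: measurableT_comp.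
    exact: measurableT_comp.
  apply: measurableT_comp => //.
  by apply: measurable_funM => //; exact: measurableT_comp.
move=> [u v]; have [->|u0] := eqVneq u 0.
  rewrite (_ : [set _ | _] = set0) ?measure0.
    by rewrite lee_fin invr_ge0; lra.
  by apply/seteqP; split => w; rewrite /V /= eqxx => -[].
rewrite [X in P X](_ : _ = (fun w => A w i j) @^-1`
    [set x | tau * `|x * u + v| <= `|x * u|]); last first.
  by apply/seteqP; split => w; rewrite /V /X /= ?u0 => // -[].
rewrite (gpm_normal gA ijS) ?normal_prob_ratio//.
have mxu : measurable_fun setT (fun x : R => x * u).
  by apply: measurable_funM => //; exact: measurable_cst.
apply: measurable_set_ler; last exact: measurableT_comp.
apply: measurable_funM; first exact: measurable_cst.
apply: measurableT_comp => //; exact: measurable_funD.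
Qed.

(* Replace the entries of the witness [B] by those of [A] one at a time; the
   event that [f] vanishes after a replacement but not before lies in a
   [ratio_event tau] for every [tau]. *)
Lemma prob_mix_mx_eq0 B (J : {set 'I_n * 'I_n}) : J \subset S -> f B != 0 ->
  P [set w | f (mix_mx J B w) = 0] = 0%E.
Proof.
move=> JS fB.
have mf0 (K : {set 'I_n * 'I_n}) : K \subset S ->
    measurable [set w | f (mix_mx K B w) = 0].
  move=> KS; apply: measurable_set_eq0; apply: mf.
  exact: measurable_mix_mx_all.
elim: {J}_.+1 {-2}J (ltnSn #|J|) JS => // m IH J; rewrite ltnS => Jm JS.
have [->|/set0Pn[[i j] ijJ]] := eqVneq J finset.set0.
  rewrite (_ : [set _ | _] = set0) ?measure0//.
  by apply/seteqP; split => w //=; rewrite mix_mx0; apply/eqP.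
set J' := J :\ (i, j).
have J'S : J' \subset S by rewrite (fintype.subset_trans _ JS)// subsetDl.
have IHJ' := IH J' _ J'S.
have bound tau : 1 < tau ->
    (P [set w | f (mix_mx J B w) = 0%R] <= ((tau - 1)^-1)%:E)%E.
  move=> tau1.
  have mr := measurable_ratio_event tau i j (measurable_mix_mx_all B JS).
  apply: (@le_trans _ _ (P ([set w | f (mix_mx J' B w) = 0%R] `|`
      ratio_event tau (mix_mx J B) i j))).
    apply: le_measure; rewrite ?inE; [exact: mf0| |].
      by apply: measurableU => //; exact: mf0.
    move=> w /= fJ0.
    have [|fJ'0] := eqVneq (f (mix_mx J' B w)) 0; first by left.
    right; split; last by rewrite fJ0 normr0 mulr0.
    (* With zero slope the replacement would leave the value of [f] unchanged. *)
    apply: contra_neqN fJ'0 => /eqP.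
    move: fJ0; rewrite (mix_mxD1 B w ijJ) slopeD// f_aff -/J'.
    by rewrite -/(slope f i j (mix_mx J' B w)) => + s0; rewrite s0 mulr0 addr0.
  apply: (le_trans (measureU2 _ (mf0 _ J'S) mr)).
  rewrite -[leRHS]add0e; apply: leeD; last exact: le_ratio_event.
  rewrite le_eqVlt; apply/orP; left; apply/eqP; apply: IHJ' => //.
  by rewrite (leq_trans _ Jm)// (cardsD1 (i, j) J) ijJ.
apply/eqP; rewrite eq_le measure_ge0 andbT; apply/lee_addgt0Pr => e e0.
(* This [tau] makes the bound exactly [e]. *)
rewrite add0e (le_trans (bound (e^-1 + 1) _)) ?ltrDr ?invr_gt0//.
by rewrite addrK invrK.
Qed.

Lemma prob_pattern_eq0 B : pattern_mx S B -> f B != 0 ->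
  P [set w | f (A w) = 0] = 0%E.
Proof.
move=> BS fB; rewrite -[RHS](prob_mix_mx_eq0 (subxx S) fB).
by rewrite mix_mx_pattern.
Qed.

Lemma le_ratio_event_pattern tau i j : (i, j) \in S -> 1 < tau ->
  (P (ratio_event tau A i j) <= ((tau - 1)^-1)%:E)%E.
Proof.
move=> ijS tau1; have := le_ratio_event (0 : 'M[R]_n) (subxx S) ijS tau1.
by rewrite mix_mx_pattern// => k l _; rewrite mxE.
Qed.

End gaussian_pattern.

(** * Proof of the tail bound *)

Lemma mem_bigsetU (T : Type) (I : finType) (Q : pred I) (F : I -> set T) i x :
  Q i -> F i x -> (\big[setU/set0]_(i | Q i) F i) x.
Proof. by move=> Qi Fx; rewrite (bigD1 i)//=; left. Qed.

Lemma Boole_inequality_fin d (T : measurableType d) (R : realType)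
    (P : probability T R) (I : finType) (Q : pred I) (F : I -> set T) :
  (forall i, Q i -> measurable (F i)) ->
  (P (\big[setU/set0]_(i | Q i) F i) <= \sum_(i | Q i) P (F i))%E.
Proof.
move=> mF.
pose K (U : set T) (x : \bar R) := measurable U /\ (P U <= x)%E.
suff [] : K (\big[setU/set0]_(i | Q i) F i) (\sum_(i | Q i) P (F i))%E by [].
apply: (big_ind2 K) => [|U x V y [mU Ux] [mV Vy]|i Qi].
- by split; [exact: measurable0|rewrite measure0].
- split; first exact: measurableU.
  by rewrite (le_trans (measureU2 _ mU mV))// leeD.
- by split; [exact: mF|].
Qed.

(** [inv_sens] with the squared determinant cleared, which keeps its meaning on singular
    matrices. *)
Definition adj_sens (R : realType) (n : nat) (B : 'M[R]_n) k l :=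
  \sum_i \sum_j `|(\adj B) k i * B i j * (\adj B) j l|.

Lemma invmx_adj (R : realType) (n : nat) (B : 'M[R]_n) k l :
  B \in unitmx -> invmx B k l = (\det B)^-1 * (\adj B) k l.
Proof. by move=> Bu; rewrite /invmx Bu mxE. Qed.

Lemma inv_sensE (R : realType) (n : nat) (B : 'M[R]_n) k l :
  B \in unitmx -> inv_sens B k l = adj_sens B k l / `|\det B| ^+ 2.
Proof.
move=> Bu; rewrite /adj_sens mulr_suml; apply: eq_bigr => i _.
rewrite mulr_suml; apply: eq_bigr => j _; rewrite !invmx_adj//.
by rewrite !normrM normfV -exprVn; ring.
Qed.

(** For nonsingular [B] and [t > 0], the condition number of the entry is at least [t], without
    division. Positivity excludes [0 <= 0] at an entry whose condition number is 0. *)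
Definition ill_conditioned (R : realType) (n : nat) (t : R) (B : 'M[R]_n) k l :=
  0 < adj_sens B k l /\ t * `|(\adj B) k l * \det B| <= adj_sens B k l.

Lemma le_cw_cond_invP (R : realType) (n : nat) (B : 'M[R]_n) t :
  0 < t -> (t%:E <= cw_cond_inv B)%E <->
  \det B = 0 \/ exists k l, ill_conditioned t B k l.
Proof.
move=> t0; have [Bu|Bu] := boolP (B \in unitmx); last first.
  rewrite /cw_cond_inv (negbTE Bu) leey; split => // _; left.
  by move: Bu; rewrite unitmxE unitfE negbK => /eqP.
have D0 : \det B != 0 by rewrite -unitfE -unitmxE.
have D1 : 0 < `|\det B| by rewrite normr_gt0.
have ill k l :
    (0 < inv_sens B k l) && (t * `|invmx B k l| <= inv_sens B k l) <->
    ill_conditioned t B k l.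
  rewrite inv_sensE// invmx_adj// pmulr_lgt0 ?invr_gt0 ?exprn_gt0//.
  rewrite ler_pdivlMr ?exprn_gt0// normrM normfV.
  rewrite (_ : _ * _ * _ = t * `|(\adj B) k l * \det B|).
    by split => [/andP[]|[-> ->]].
  by rewrite normrM; field; rewrite normr_eq0.
rewrite le_cw_cond_inv//; split => [/existsP[k /existsP[l /ill kl]]|].
  by right; exists k, l.
case=> [/eqP|[k [l /ill kl]]]; first by rewrite (negbTE D0).
by apply/existsP; exists k; apply/existsP; exists l.
Qed.

(** One of the at most [#|S|] nonzero summands reaches [2 * tau] times the modulus of [a * D]. By
    [slope_adj] it splits into a determinant part and an adjugate part, one of which carries half of
    that. *)
Lemma ill_conditioned_ratio (R : realType) (n : nat) (S : {set 'I_n * 'I_n})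
    (B : 'M[R]_n) tau k l :
  pattern_mx S B -> \det B != 0 -> (\adj B) k l != 0 -> 0 < tau ->
  ill_conditioned (2 * #|S|%:R * tau) B k l ->
  exists i j, (i, j) \in S /\
    (tau * `|\det B| <= `|B i j * (\adj B) j i| \/
     i != l /\ tau * `|(\adj B) k l| <=
       `|B i j * slope (fun C : 'M[R]_n => (\adj C) k l) i j B|).
Proof.
move=> BS D0 a0 tau0 [sens0 illB].
set D := \det B in D0 illB *; set a := (\adj B) k l in a0 illB *.
pose b (ij : 'I_n * 'I_n) := `|(\adj B) k ij.1 * B ij.1 ij.2 * (\adj B) ij.2 l|.
have : exists2 ij, ij \in S & 2 * tau * `|a * D| <= b ij.
  apply: contrapT => /forall2NP bS.
  have bS' ij : ij \in S -> b ij < 2 * tau * `|a * D|.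
    by move=> ijS; case: (bS ij) => // /negP; rewrite -ltNge.
  have sensE : adj_sens B k l = \sum_(ij in S) b ij.
    rewrite /adj_sens pair_bigA/= [RHS]big_mkcond/=; apply: eq_bigr => -[i j] _.
    by case: ifPn => //= ijS; rewrite BS// mulr0 mul0r normr0.
  have : adj_sens B k l < \sum_(ij in S) 2 * tau * `|a * D|.
    have [S0|/set0Pn[ij ijS]] := eqVneq S finset.set0.
      by move: sens0; rewrite sensE S0 big_set0 ltxx.
    rewrite sensE; apply: ltr_sum => [|//].
    by apply/hasP; exists ij => //; rewrite mem_index_enum.
  rewrite sumr_const -mulr_natl ltNge => /negP; apply.
  by rewrite (le_trans _ illB)//; lra.
case=> -[i j] ijS; rewrite /b/= => bij; exists i, j; split => //.
set E := slope _ i j B; set c := (\adj B) j i.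
have EE : (\adj B) k i * (\adj B) j l = c * a - D * E.
  by rewrite slope_adj /c /a; ring.
have [|c1] := leP (tau * `|D|) `|B i j * c|; first by left.
have [E1|E1] := leP (tau * `|a|) `|B i j * E|; last first.
  exfalso; move: bij; rewrite [(\adj B) k i * _ * _]mulrAC EE mulrBl.
  move=> /le_trans/(_ (ler_normB _ _)).
  rewrite !normrM leNgt => /negP; apply; rewrite !normrM in c1 E1.
  have a1 : 0 < `|a| by rewrite normr_gt0.
  have D1 : 0 < `|D| by rewrite normr_gt0.
  have := ltr_pM2r a1 (`|B i j| * `|c|) (tau * `|D|).
  rewrite c1 => h1.
  have := ltr_pM2r D1 (`|B i j| * `|E|) (tau * `|a|).
  rewrite E1 => h2.
  lra.
(* The entry [(k, l)] of the adjugate is a cofactor with row [l] deleted, so its slope vanishes when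
   [i = l]. *)
right; split => //; apply: contraTN E1 => /eqP il.
have : D * E = 0 by rewrite slope_adj il; ring.
move/eqP; rewrite mulf_eq0 (negbTE D0)/= => /eqP ->.
by rewrite mulr0 normr0 -ltNge mulr_gt0 ?normr_gt0.
Qed.

(** An adjugate entry vanishing on the whole pattern has zero slope along [S]; [slope_adj] then
    annihilates every summand of [adj_sens]. *)
Lemma adj_eq0_not_ill (R : realType) (n : nat) (S : {set 'I_n * 'I_n}) t
    (B : 'M[R]_n) k l :
  pattern_mx S B -> (forall C : 'M[R]_n, pattern_mx S C -> (\adj C) k l = 0) ->
  ~ ill_conditioned t B k l.
Proof.
move=> BS adj0 [+ _]; rewrite lt_def => /andP[/eqP + _]; apply.
rewrite /adj_sens big1// => i _; rewrite big1// => j _; apply/eqP.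
rewrite normr_eq0; have [ijS|/BS ->] := boolP ((i, j) \in S); last first.
  by rewrite mulr0 mul0r.
rewrite mulrAC.
have := slope_adj B i j k l; rewrite /slope !adj0 ?subrr//.
  rewrite !mulr0 sub0r => /esym/eqP; rewrite oppr_eq0 => /eqP ->.
  by rewrite mul0r.
move=> i' j' ijS'; rewrite !mxE BS// add0r.
by rewrite -xpair_eqE; case: eqP ijS' => // ->; rewrite ijS.
Qed.

Lemma measurable_ill_conditioned d (T : measurableType d) (R : realType)
    (n : nat) (t : R) (M : T -> 'M[R]_n) k l :
  measurable_mx M -> measurable [set w | ill_conditioned t (M w) k l].
Proof.
move=> mM.
have msens : measurable_fun setT (fun w => adj_sens (M w) k l).
  apply: measurable_sum => i; apply: measurable_sum => j.
  apply: measurableT_comp => //; apply: measurable_funM.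
    by apply: measurable_funM; [exact: (mx_measurable_adj k i mM)|exact: mM].
  exact: (mx_measurable_adj j l mM).
apply: measurableI; first exact: measurable_set_ltr.
apply: measurable_set_ler => //; apply: measurable_funM => //.
apply: measurableT_comp => //; apply: measurable_funM.
  exact: (mx_measurable_adj k l mM).
exact: (mx_measurable_det mM).
Qed.

Theorem theorem2 (R : realType) (n : nat) (S : {set 'I_n * 'I_n})
    (d : measure_display) (T : measurableType d) (P : probability T R)
    (A : T -> 'M[R]_n) (t : R) :
  (1 <= n)%N ->
  ~ (pattern_mx S `<=` @singular_mx R n) ->
  gaussian_pattern_mx P S A ->
  2 * #|S|%:R <= t ->
  (P [set w | t%:E <= cw_cond_inv (A w)]
     <= (4 * #|S|%:R ^+ 2 * n%:R ^+ 2 * t^-1)%:E)%E.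
Proof.
move=> n1 /nonsubset[B0 [B0S B0u]] gA st.
have dB0 : \det B0 != 0.
  by rewrite -unitfE -unitmxE; apply/negPn/negP.
(* An empty [S] would force [B0 = 0], which is singular since [n >= 1]. *)
have s1 : (0 < #|S|)%N.
  rewrite card_gt0; apply/eqP => S0; move/eqP: dB0; apply.
  rewrite (_ : B0 = 0); last first.
    by apply/matrixP => i j; rewrite mxE B0S// S0 inE.
  by case: n n1 {S A gA st B0 B0S B0u S0} => // m _; exact: det0.
set s : R := #|S|%:R in st *.
have s1R : 1 <= s by rewrite /s ler1n.
have n1R : 1 <= n%:R :> R by rewrite ler1n.
have t0 : 0 < t by lra.
have mA : measurable_mx A := measurable_gaussian_pattern gA.
pose adjf k l := fun B : 'M[R]_n => (\adj B) k l.
pose detf := fun B : 'M[R]_n => \det B.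
have adjf_aff k l : multiaffine (adjf k l) by exact: multiaffine_adj.
have detf_aff : multiaffine detf by exact: multiaffine_det.
have madjf k l : mx_measurable (adjf k l) by exact: mx_measurable_adj.
have mdetf : mx_measurable detf by exact: mx_measurable_det.
have m0 f : mx_measurable f -> measurable [set w | f (A w) = 0].
  by move=> mf; apply: measurable_set_eq0; exact: mf.
set Ev := [set _ | _].
have mEv : measurable Ev.
  rewrite (_ : Ev = [set w | detf (A w) = 0] `|`
      \bigcup_k \bigcup_l [set w | ill_conditioned t (A w) k l]).
    apply: measurableU; first exact: m0.
    apply: fin_bigcup_measurable => // k _.
    apply: fin_bigcup_measurable => // l _.
    exact: measurable_ill_conditioned.
  apply/seteqP; split => w /= => [/(le_cw_cond_invP _ t0)|H].
    by case=> [|[k [l kl]]]; [left|right; exists k => //; exists l].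
  apply/(le_cw_cond_invP _ t0).
  by case: H => [|[k _ [l _ kl]]]; [left|right; exists k, l].
(* A claimed bound of at least 1 is trivial; otherwise [t] is large enough for [tau2] below. *)
have [tbig|tsmall] := leP t (4 * s ^+ 2 * n%:R ^+ 2).
  rewrite (le_trans (probability_le1 P mEv))// lee_fin ler_pdivlMr//.
  by rewrite mul1r.
pose tau := t / (2 * s).
have tE : t = 2 * s * tau by rewrite /tau; field; lra.
have tau2 : 2 * s * n%:R ^+ 2 < tau.
  by rewrite /tau ltr_pdivlMr ?mulr_gt0//; [lra|lra].
have sn1 : 1 <= s * n%:R ^+ 2 by nra.
have tau1 : 1 < tau by lra.
(* Adjugate entries that are nonzero somewhere on the pattern vanish with probability 0; the others
   fall under [adj_eq0_not_ill]. *)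
pose nz k l := `[< exists2 B, pattern_mx S B & adjf k l B != 0 >].
pose Z kl := [set w | adjf kl.1 kl.2 (A w) = 0].
pose U1 := [set w | detf (A w) = 0].
pose U2 := \big[setU/set0]_(kl : 'I_n * 'I_n | nz kl.1 kl.2) Z kl.
pose U3 := \big[setU/set0]_(ij in S) ratio_event A detf tau A ij.1 ij.2.
pose U4 := \big[setU/set0]_(ij in S) \big[setU/set0]_(kl | kl.2 != ij.1)
  ratio_event A (adjf kl.1 kl.2) tau A ij.1 ij.2.
have ratioE f i j w : slope f i j (A w) != 0 ->
    tau * `|f (A w)| <= `|A w i j * slope f i j (A w)| ->
    ratio_event A f tau A i j w by move=> ? ?; split.
have sub : Ev `<=` U1 `|` (U2 `|` (U3 `|` U4)).
  move=> w /(le_cw_cond_invP _ t0) [|[k [l ill]]]; first by left.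
  have AS := gpm_zero gA w.
  have [D0|D0] := eqVneq (detf (A w)) 0; first by left.
  right.
  have [a0|a0] := eqVneq (adjf k l (A w)) 0.
    left; rewrite /U2; apply: (@mem_bigsetU _ _ _ _ (k, l)) => //=.
    apply/asboolP; apply: contrapT => /forall2NP nzN.
    apply: (adj_eq0_not_ill AS _ ill) => C CS; apply/eqP.
    by case: (nzN C) => // /negP/negPn.
  right; rewrite tE in ill.
  have [i [j [ijS [H|[il H]]]]] :=
    ill_conditioned_ratio AS D0 a0 (lt_trans ltr01 tau1) ill.
    left; rewrite /U3; apply: (@mem_bigsetU _ _ _ _ (i, j)) => //=.
    rewrite -slope_det in H; apply: ratioE => //.
    (* A zero slope would make the right side 0, while the left side is positive because [D0]
       holds. *)
    apply: contraTneq H => ->; rewrite mulr0 normr0 -ltNge.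
    by rewrite mulr_gt0 ?normr_gt0//; lra.
  right; rewrite /U4; apply: (@mem_bigsetU _ _ _ _ (i, j)) => //=.
  apply: (@mem_bigsetU _ _ _ _ (k, l)) => /=; first by rewrite eq_sym.
  apply: ratioE => //.
  apply: contraTneq H => ->; rewrite mulr0 normr0 -ltNge.
  by rewrite mulr_gt0 ?normr_gt0//; lra.
have mU1 : measurable U1 by exact: m0.
have mU2 : measurable U2.
  by apply: bigsetU_measurable => kl _; apply: m0; exact: madjf.
have mratio f i j : mx_measurable f -> measurable (ratio_event A f tau A i j).
  by move=> mf; exact: (measurable_ratio_event gA).
have mU3 : measurable U3 by apply: bigsetU_measurable => ij _; exact: mratio.
have mU4' ij : measurable (\big[setU/set0]_(kl : 'I_n * 'I_n | kl.2 != ij.1)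
    ratio_event A (adjf kl.1 kl.2) tau A ij.1 ij.2).
  by apply: bigsetU_measurable => kl _; exact: mratio.
have mU4 : measurable U4 by exact: bigsetU_measurable.
pose p := (tau - 1)^-1.
have PU1 : (P U1 <= 0)%E.
  by rewrite (prob_pattern_eq0 gA detf_aff mdetf B0S).
have PU2 : (P U2 <= 0)%E.
  rewrite (le_trans (Boole_inequality_fin _ _))//.
    by move=> kl _; apply: m0; exact: madjf.
  rewrite big1// => kl /asboolP[C CS C0].
  by rewrite (prob_pattern_eq0 gA (adjf_aff _ _) (madjf _ _) CS).
have PU3 : (P U3 <= (s * p)%:E)%E.
  rewrite (le_trans (Boole_inequality_fin _ _))//.
    by move=> ij _; exact: mratio.
  apply: (@le_trans _ _ (\sum_(ij in S) p%:E)%E).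
    by apply: lee_sum => -[i j] ijS; exact: (le_ratio_event_pattern gA).
  by rewrite sumEFin sumr_const mulr_natl.
have PU4 : (P U4 <= (s * ((n%:R - 1) * n%:R) * p)%:E)%E.
  rewrite (le_trans (Boole_inequality_fin _ _))//.
  apply: (@le_trans _ _ (\sum_(ij in S) (((n%:R - 1) * n%:R) * p)%:E)%E).
    apply: lee_sum => -[i j] ijS.
    rewrite (le_trans (Boole_inequality_fin _ _))//.
      by move=> kl _; exact: mratio.
    apply: (@le_trans _ _ (\sum_(kl : 'I_n * 'I_n | kl.2 != i) p%:E)%E).
      by apply: lee_sum => kl _; exact: (le_ratio_event_pattern gA).
    rewrite sumEFin lee_fin.
    (* There are [n] choices of [k] and, thanks to [l != i], only [n - 1] of [l]. *)
    rewrite -(pair_big predT [pred l | l != i] (fun _ _ => p))/=.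
    rewrite (eq_bigr (fun=> (n%:R - 1) * p)) => [|k _]; last first.
      by rewrite sumr_const cardC1 card_ord -[LHS]mulr_natl -subn1 natrB.
    by rewrite sumr_const card_ord -[leLHS]mulr_natl; lra.
  by rewrite sumEFin sumr_const -[X in (X%:E <= _)%E]mulr_natl mulrA.
apply: (@le_trans _ _ (s * (1 + (n%:R - 1) * n%:R) * p)%:E); last first.
  rewrite lee_fin tE /p.
  set N : R := n%:R in n1R sn1 tau2 *.
  have sN : N ^+ 2 <= s * N ^+ 2 by rewrite ler_peMl// sqr_ge0.
  rewrite (_ : _ * _^-1 = 2 * N ^+ 2 * s / tau); last by field; lra.
  rewrite ler_pdivrMr ?subr_gt0// mulrAC ler_pdivlMr; last by lra.
  (* The claim with denominators and [s] cleared; it holds as [N ^+ 2 + N - 1 >= 1] and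
     [tau > 2 * s * N ^+ 2]. The saving from [l != i] absorbs the passage from [tau - 1] to
     [tau]. *)
  have : 2 * N ^+ 2 <= (N ^+ 2 + N - 1) * tau by nra.
  rewrite -(ler_pM2l (lt_le_trans ltr01 s1R)); lra.
have mU34 : measurable (U3 `|` U4) by exact: measurableU.
have mU234 : measurable (U2 `|` (U3 `|` U4)) by exact: measurableU.
apply: (@le_trans _ _ (P U1 + (P U2 + (P U3 + P U4)))%E).
  apply: (le_trans (le_measure P _ _ sub)); rewrite ?inE//.
    exact: measurableU.
  apply: (le_trans (measureU2 _ mU1 mU234)); apply: leeD => //.
  apply: (le_trans (measureU2 _ mU2 mU34)); apply: leeD => //.
  exact: measureU2.
rewrite (_ : (s * _ * p)%:E =
    (0 + (0 + ((s * p)%:E + (s * ((n%:R - 1) * n%:R) * p)%:E)))%E).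
  by do 3 (apply: leeD => //).
by rewrite !add0e -EFinD mulrDr mulr1 mulrDl.
Qed.
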